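(* Let $\mathbb{O} = \{y\in\mathbb{R}^n : A y \preceq_{\mathcal K} b\}$ be an obstacle, where $A\in\mathbb{R}^{l\times n}$, $b\in\mathbb{R}^l$, $n\ge 1$, $\mathcal K\subset\mathbb{R}^l$ is a closed convex pointed cone with non-empty interior, and $\mathbb{O}$ is a convex compact set with non-empty relative interior. Let the controlled object be a point mass at position $p\in\mathbb{R}^n$, i.e. $\mathbb{E}(x)=p$ (identified with the set $\{p\}$). Let $\|\cdot\|$ be a norm on $\mathbb{R}^n$ with dual norm $\|\cdot\|_*$. Then, for any $\mathsf{d}\in\mathbb{R}$, $$\mathrm{sd}(\mathbb{E}(x),\mathbb{O}) > \mathsf{d} \iff \exists\, \lambda \succeq_{\mathcal K^*} 0 :\ (A p - b)^\top \lambda > \mathsf{d},\ \ \|A^\top \lambda\|_* = 1.$$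
   Context: For a cone $\mathcal K\subset\mathbb{R}^l$ and $a,c\in\mathbb{R}^l$, $a\preceq_{\mathcal K} c$ means $c-a\in\mathcal K$. $\mathcal K^*=\{\lambda\in\mathbb{R}^l : \lambda^\top s\ge 0 \text{ for all } s\in\mathcal K\}$ is the dual cone, and $\lambda\succeq_{\mathcal K^*}0$ means $\lambda\in\mathcal K^*$. The dual norm is $\|z\|_*=\max\{z^\top y : \|y\|\le 1\}$. For sets $\mathbb{E},\mathbb{O}\subset\mathbb{R}^n$, the distance is $\mathrm{dist}(\mathbb{E},\mathbb{O}) := \min_{t\in\mathbb{R}^n}\{\|t\| : (\mathbb{E}+t)\cap\mathbb{O}\neq\emptyset\}$, the penetration is $\mathrm{pen}(\mathbb{E},\mathbb{O}) := \inf_{t\in\mathbb{R}^n}\{\|t\| : (\mathbb{E}+t)\cap\mathbb{O}=\emptyset\}$, and the signed distance is $\mathrm{sd}(\mathbb{E},\mathbb{O}) := \mathrm{dist}(\mathbb{E},\mathbb{O}) - \mathrm{pen}(\mathbb{E},\mathbb{O})$. *)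

(* Defs.v *)
From HB Require Import structures.
From mathcomp Require Export all_boot all_order all_algebra.
From mathcomp Require Export all_classical all_reals all_analysis.

Set Implicit Arguments.
Unset Strict Implicit.
Unset Printing Implicit Defensive.

Import Order.TTheory GRing.Theory Num.Theory.
Import numFieldNormedType.Exports.

Local Open Scope classical_set_scope.
Local Open Scope ring_scope.

(* R^n is 'cV[R]_n with the library's (sup-norm) topology, which on R^n is the
   topology of every norm. *)

Definition dot (R : realType) (n : nat) (u v : 'cV[R]_n) : R := (u^T *m v) 0 0.

Definition cone (R : realType) (V : lmodType R) (K : set V) : Prop :=
  forall (a : R) (x : V), 0 <= a -> K x -> K (a *: x).

Definition pointed_cone (R : realType) (V : lmodType R) (K : set V) : Prop :=
  forall x : V, K x -> K (- x) -> x = 0.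

Definition cone_le (R : realType) (V : lmodType R) (K : set V) (a c : V) : Prop :=
  K (c - a).

Definition dual_cone (R : realType) (l : nat) (K : set 'cV[R]_l) : set 'cV[R]_l :=
  [set lam | forall s, K s -> 0 <= dot lam s].

Definition affine_hull (R : realType) (V : lmodType R) (S : set V) : set V :=
  [set x | exists (k : nat) (theta : 'I_k -> R) (z : 'I_k -> V),
     [/\ forall i, S (z i),
         \sum_i theta i = 1
       & x = \sum_i theta i *: z i]].

Definition relative_interior (R : realType) (V : normedModType R) (S : set V) :
    set V :=
  [set x | S x /\ \forall y \near x, affine_hull S y -> S y].

(* Nonnegativity of N follows from these axioms. *)
Definition is_norm (R : realType) (V : lmodType R) (N : V -> R) : Prop :=
  [/\ forall x, N x = 0 -> x = 0,
      forall (a : R) x, N (a *: x) = `|a| * N x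
    & forall x y, N (x + y) <= N x + N y].

(* For a norm N the supremum is a maximum: the N-unit ball is compact. *)
Definition dual_norm (R : realType) (n : nat) (N : 'cV[R]_n -> R)
    (z : 'cV[R]_n) : R :=
  sup [set dot z y | y in [set y | N y <= 1]].

Definition translate (R : realType) (V : lmodType R) (E : set V) (t : V) : set V :=
  [set e + t | e in E].

(* Distance and penetration are infima in the extended reals, so that an empty
   set of admissible t gives +oo rather than a junk real value.  At most one of
   the two is +oo: the first only if E or O is empty, and then t = 0 shows that
   the second is finite.  Hence sdist never evaluates +oo - +oo. *)
Definition dist (R : realType) (V : lmodType R) (N : V -> R) (E O : set V) : \bar R :=
  ereal_inf [set (N t)%:E | t in [set t | translate E t `&` O !=set0]].

Definition penetration (R : realType) (V : lmodType R) (N : V -> R) (E O : set V) :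
    \bar R :=
  ereal_inf [set (N t)%:E | t in [set t | translate E t `&` O = set0]].

Definition sdist (R : realType) (V : lmodType R) (N : V -> R) (E O : set V) : \bar R :=
  (dist N E O - penetration N E O)%E.

Definition obstacle (R : realType) (l n : nat) (K : set 'cV[R]_l)
    (A : 'M[R]_(l, n)) (b : 'cV[R]_l) : set 'cV[R]_n :=
  [set y | cone_le K (A *m y) b].

(* Main.v *)
From mathcomp Require Import ring lra.
Require Import Defs.
Import Order.TTheory GRing.Theory Num.Theory.
Import numFieldNormedType.Exports.
Local Open Scope classical_set_scope.
Local Open Scope ring_scope.

(** For a unit dual vector z = A^T lam with lam in K^*, the half-space
    z . y <= b . lam contains the obstacle O, and (A p - b) . lam =
    z . p - b . lam is the signed N-distance from p to its boundary.  So the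
    theorem says that the signed distance to O is the supremum of the signed
    distances to the half-spaces of this form.

    A certificate bounds the signed distance from below
    ([certificate_le_sdist]).  If p lies outside O, then every t with p + t in
    O has to cross the slab between p and the half-space, so N t is at least
    the certified value.  If p lies inside O, pushing p along a direction that
    almost attains the dual norm of z leaves the half-space, hence O, and this
    bounds the penetration from above.

    Conversely ([sdist_certificate]), a signed distance larger than d yields a
    compact convex set C disjoint from O: for d < 0 a single point p + t with
    N t < - d, for d >= 0 an N-ball around p of radius r > d.  That C misses O
    means that b is not in A C + K.  This sum of a compact set and a closed
    cone is closed, so its nearest point to b separates b from it
    ([separating_functional]); the separating vector lam lies in K^* because K
    is a cone.  Since O is nonempty, A^T lam cannot vanish, and lam can be
    scaled so that A^T lam has dual norm 1 ([dual_certificate]).  Evaluating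
    lam on C gives (A p - b) . lam > d.

    The separation takes place in the constraint space R^l because a support
    functional z of O need not be of the form A^T lam when A y - b only reaches
    the boundary of - K; separating b from A C + K produces lam directly. *)

Set Implicit Arguments.
Unset Strict Implicit.
Unset Printing Implicit Defensive.

(** * The Euclidean pairing *)

Section Dot.
Context {R : realType} {n : nat}.
Implicit Types u v w : 'cV[R]_n.

Lemma dotE u v : dot u v = \sum_i u i 0 * v i 0.
Proof. by rewrite /dot mxE; apply: eq_bigr => i _; rewrite mxE. Qed.

Lemma dotC u v : dot u v = dot v u.
Proof. by rewrite !dotE; apply: eq_bigr => i _; rewrite mulrC. Qed.

Lemma dotDr u v w : dot u (v + w) = dot u v + dot u w.
Proof. by rewrite /dot mulmxDr mxE. Qed.

Lemma dotZr (a : R) u v : dot u (a *: v) = a * dot u v.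
Proof. by rewrite /dot -scalemxAr mxE. Qed.

Lemma dotNr u v : dot u (- v) = - dot u v.
Proof. by rewrite -scaleN1r dotZr mulN1r. Qed.

Lemma dotBr u v w : dot u (v - w) = dot u v - dot u w.
Proof. by rewrite dotDr dotNr. Qed.

Lemma dot0r u : dot u 0 = 0.
Proof. by rewrite -(scale0r 0) dotZr mul0r. Qed.

Lemma dotDl u v w : dot (u + v) w = dot u w + dot v w.
Proof. by rewrite dotC dotDr !(dotC w). Qed.

Lemma dotZl (a : R) u v : dot (a *: u) v = a * dot u v.
Proof. by rewrite dotC dotZr dotC. Qed.

Lemma dotBl u v w : dot (u - v) w = dot u w - dot v w.
Proof. by rewrite dotC dotBr !(dotC w). Qed.

Lemma dot0l v : dot 0 v = 0.
Proof. by rewrite dotC dot0r. Qed.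

Lemma sqr_coord_le_dot u i : u i 0 ^+ 2 <= dot u u.
Proof.
rewrite dotE (bigD1 i) //= -expr2 lerDl sumr_ge0 // => j _.
by rewrite -expr2 sqr_ge0.
Qed.

Lemma dot_ge0 u : 0 <= dot u u.
Proof. by rewrite dotE sumr_ge0// => i _; rewrite -expr2 sqr_ge0. Qed.

Lemma dot_gt0 u : u != 0 -> 0 < dot u u.
Proof.
move=> u0; have [i ui0] : exists i, u i 0 != 0.
  apply/existsP; apply: contraNT u0; rewrite negb_exists => /forallP u0.
  by apply/eqP/colP => i; rewrite mxE; apply/eqP; move: (u0 i); rewrite negbK.
by apply: lt_le_trans (sqr_coord_le_dot u i); rewrite exprn_even_gt0.
Qed.

End Dot.

Lemma dot_mulmxl (R : realType) (l n : nat) (A : 'M[R]_(l, n)) y lam :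
  dot (A *m y) lam = dot (A^T *m lam) y.
Proof. by rewrite dotC /dot trmx_mul trmxK mulmxA. Qed.

(** * Topology of column vectors *)

Lemma coord_le_norm (R : realType) (n : nat) (x : 'cV[R]_n) i : `|x i 0| <= `|x|.
Proof.
rewrite [leRHS]/Num.norm /= mx_normrE; apply/bigmax_geP; right => /=.
by exists (i, 0).
Qed.

Lemma norm_trmx (R : realType) (m n : nat) (x : 'M[R]_(m, n)) : `|x^T| = `|x|.
Proof.
have le_tr p q (z : 'M[R]_(p, q)) : `|z^T| <= `|z|.
  rewrite [leLHS]/Num.norm [leRHS]/Num.norm /= !mx_normrE; apply/bigmax_leP.
  split=> [|[i j] _ /=]; first by apply: bigmax_ge_id.
  by rewrite mxE; apply/bigmax_geP; right; exists (j, i).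
by apply/eqP; rewrite eq_le le_tr -{1}(trmxK x) le_tr.
Qed.

Lemma lipschitz_continuous (R : realType) (V W : normedModType R) (f : V -> W)
    (M : R) :
  (forall x y, `|f x - f y| <= M * `|x - y|) -> continuous f.
Proof.
move=> f_lip x; apply/cvgrPdist_lt => e e0.
have M1 : 0 < `|M| + 1 by rewrite ltr_wpDl.
near=> y; apply: le_lt_trans (f_lip x y) _.
apply: (@le_lt_trans _ _ ((`|M| + 1) * `|x - y|)).
  by rewrite ler_wpM2r// (le_trans (ler_norm M))// lerDl.
rewrite mulrC -ltr_pdivlMr//; near: y.
by apply: cvgr_dist_lt; rewrite ?divr_gt0.
Unshelve. all: by end_near. Qed.

Lemma trmx_continuous (R : realType) (m n : nat) :
  continuous (fun x : 'M[R]_(m, n) => x^T).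
Proof.
apply: (@lipschitz_continuous R 'M[R]_(m, n) 'M[R]_(n, m) _ 1) => x y.
by rewrite -linearB norm_trmx mul1r.
Qed.

(** Transposition is a homeomorphism, which carries the Heine-Borel theorem over
    from row vectors. *)
Lemma bounded_closed_compact_cV (R : realType) (n : nat) (S : set 'cV[R]_n) (M : R) :
  (forall x, S x -> `|x| <= M) -> closed S -> compact S.
Proof.
move=> S_bnd S_closed.
have -> : S = (fun x : 'rV[R]_n => x^T) @` [set x | S x^T].
  apply/seteqP; split=> [x Sx|_ [x Sx <-]//].
  by exists x^T; rewrite /= trmxK.
apply: continuous_compact.
  by apply: continuous_subspaceT; exact: trmx_continuous.
apply: bounded_closed_compact.
  exists M; split; first exact: num_real.
  by move=> r Mr x /S_bnd; rewrite norm_trmx => /le_trans; apply; exact: ltW.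
by apply: preimage_closed S_closed => x _; exact: trmx_continuous.
Qed.

(** * Seminorms and continuity *)

(** Besides N itself, y |-> `|A y| and y |-> `|z . y| are seminorms, so a single
    Lipschitz bound covers every map whose continuity is at stake. *)
Definition is_seminorm (R : realType) (V : lmodType R) (N : V -> R) : Prop :=
  (forall (a : R) x, N (a *: x) = `|a| * N x) /\
  (forall x y, N (x + y) <= N x + N y).

Section Seminorm.
Context {R : realType} {V : lmodType R} {N : V -> R}.
Hypothesis N_semi : is_seminorm N.

Lemma seminorm0 : N 0 = 0.
Proof. by rewrite -(scale0r 0) (N_semi.1 0 0) normr0 mul0r. Qed.

Lemma seminormN x : N (- x) = N x.
Proof. by rewrite -scaleN1r N_semi.1 normrN1 mul1r. Qed.

Lemma seminorm_ge0 x : 0 <= N x.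
Proof.
have := N_semi.2 x (- x); rewrite subrr seminorm0 seminormN.
by rewrite -mulr2n pmulrn_lge0.
Qed.

End Seminorm.

Section SeminormContinuity.
Context {R : realType} {n : nat} {N : 'cV[R]_n -> R}.
Hypothesis N_semi : is_seminorm N.

(** Expand x in the canonical basis: M is the sum of the values of N on the basis
    vectors. *)
Lemma seminorm_bounded : exists M : R, forall x, N x <= M * `|x|.
Proof.
exists (\sum_(i < n) N (delta_mx i 0)) => x.
have N_sum (s : seq 'I_n) (F : 'I_n -> 'cV[R]_n) :
    N (\sum_(i <- s) F i) <= \sum_(i <- s) N (F i).
  elim: s => [|i s IH]; first by rewrite !big_nil (seminorm0 N_semi).
  by rewrite !big_cons; apply: le_trans (N_semi.2 _ _) _; rewrite lerD2l.
have x_coord : \sum_i x i 0 *: delta_mx i 0 = x.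
  by rewrite [RHS]matrix_sum_delta; apply: eq_bigr => i _; rewrite big_ord1.
rewrite -{1}x_coord; apply: le_trans (N_sum _ _) _; rewrite mulr_suml.
apply: ler_sum => i _; rewrite N_semi.1 mulrC ler_wpM2l ?coord_le_norm//.
exact: seminorm_ge0 N_semi _.
Qed.

Lemma seminorm_continuous : continuous N.
Proof.
have [M N_le] := seminorm_bounded.
apply: (@lipschitz_continuous R 'cV[R]_n R^o _ M) => x y.
apply: le_trans (N_le (x - y)).
have N_sub u v : N u - N v <= N (u - v).
  by rewrite lerBlDr -{1}(subrK v u); exact: N_semi.2.
by rewrite ler_norml N_sub andbT lerNl opprB -(seminormN N_semi (x - y)) opprB N_sub.
Qed.

End SeminormContinuity.

(** The map y |-> `|A y| is a seminorm, hence dominated by the norm. *)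
Lemma affine_continuous (R : realType) (l n : nat) (A : 'M[R]_(l, n)) b :
  continuous (fun y : 'cV[R]_n => A *m y - b).
Proof.
have A_semi : is_seminorm (fun y : 'cV[R]_n => `|A *m y|).
  split=> [a x|x y]; first by rewrite -scalemxAr normrZ.
  by rewrite mulmxDr ler_normD.
have [M A_le] := seminorm_bounded A_semi.
apply: (@lipschitz_continuous R 'cV[R]_n 'cV[R]_l _ M) => x y.
by rewrite opprB addrA subrK -mulmxBr A_le.
Qed.

Lemma dot_self_continuous (R : realType) (n : nat) :
  continuous (fun x : 'cV[R]_n => dot x x).
Proof.
have -> : (fun x : 'cV[R]_n => dot x x) = fun x => \sum_i x i 0 * x i 0.
  by apply/funext => x; rewrite dotE.
move=> x; apply: cvg_big => [||i _]; [exact: add_continuous|exact: nbhs_filter|].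
by apply: cvgM; [exact: nbhs_filter|exact: coord_continuous..].
Qed.

Lemma norm_semi (R : realType) (V : lmodType R) (N : V -> R) :
  is_norm N -> is_seminorm N.
Proof. by case. Qed.

(** * Equivalence of norms and the dual norm *)

Section Norm.
Context {R : realType} {n : nat} {N : 'cV[R]_n -> R}.
Hypothesis N_norm : is_norm N.
Let N_semi := norm_semi N_norm.

(** N is continuous and positive on the compact unit sphere, hence bounded below
    there by some N u > 0; homogeneity does the rest. *)
Lemma sup_norm_le_norm : exists2 c : R, 0 < c & forall x, `|x| <= c * N x.
Proof.
pose S := [set x : 'cV[R]_n | `|x| = 1].
have S_compact : compact S.
  apply: (@bounded_closed_compact_cV _ _ _ 1) => [x ->//|].
  have -> : S = Num.norm @^-1` [set 1] by [].
  by apply: preimage_closed (@closed_eq _ 1) => x _; exact: norm_continuous.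
have normalize x : x != 0 -> S (`|x|^-1 *: x).
  by move=> x0; rewrite /S/= normrZ normfV normr_id mulVf ?normr_eq0.
(* The sphere is empty when n = 0. *)
have [S_empty|/set0P S0] := eqVneq S set0.
  exists 1 => // x; have [->|/normalize] := eqVneq x 0.
    by rewrite normr0 mul1r (seminorm_ge0 N_semi).
  by rewrite S_empty.
have [u /set_mem Su u_min] := compact_EVT_min S0 S_compact
  (continuous_subspaceT (seminorm_continuous N_semi)).
have Nu : 0 < N u.
  rewrite lt_neqAle (seminorm_ge0 N_semi) andbT eq_sym.
  apply: contra_eq_neq Su => /(let: And3 h _ _ := N_norm in h) ->.
  by rewrite normr0 eq_sym oner_eq0.
exists (N u)^-1 => [|x]; first by rewrite invr_gt0.
have [->|x0] := eqVneq x 0; first by rewrite normr0 (seminorm0 N_semi) mulr0.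
have := u_min _ (mem_set (normalize _ x0)).
rewrite N_semi.1 normfV normr_id -ler_pdivrMl ?invr_gt0 ?normr_gt0// invrK => H.
by rewrite mulrC ler_pdivlMr.
Qed.

(** This makes the supremum in [dual_norm] a genuine one; it rests on the N-unit
    ball being bounded. *)
Lemma dual_norm_set_has_sup z : has_sup [set dot z y | y in [set y | N y <= 1]].
Proof.
have [c c0 N_ge] := sup_norm_le_norm.
have [M dot_le] : exists M, forall y, `|dot z y| <= M * `|y|.
  by apply: seminorm_bounded; split=> [a x|x y];
    rewrite ?dotZr ?normrM// dotDr ler_normD.
split; first by exists 0, 0; rewrite /= ?(seminorm0 N_semi)// dot0r.
exists (`|M| * c) => _ [y /= Ny <-].
apply: le_trans (ler_norm _) _; apply: le_trans (dot_le y) _.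
apply: (@le_trans _ _ (`|M| * `|y|)); first by rewrite ler_wpM2r// ler_norm.
rewrite ler_wpM2l//; apply: le_trans (N_ge y) _.
by rewrite ger_pMr.
Qed.

Lemma dot_le_dual_norm z y : dot z y <= dual_norm N z * N y.
Proof.
have [y0|Ny0] := eqVneq (N y) 0.
  by have [/(_ _ y0)-> _ _] := N_norm; rewrite dot0r (seminorm0 N_semi) mulr0.
have Ny : 0 < N y by rewrite lt_neqAle eq_sym Ny0 (seminorm_ge0 N_semi).
rewrite -ler_pdivrMr// mulrC -dotZr; apply: ub_le_sup.
  by have [] := dual_norm_set_has_sup z.
by exists ((N y)^-1 *: y) => //=; rewrite N_semi.1 gtr0_norm ?invr_gt0// mulVf.
Qed.

Lemma dual_norm_gt z r : r < dual_norm N z -> exists2 y, N y <= 1 & r < dot z y.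
Proof.
by move=> /(sup_gt (dual_norm_set_has_sup z).1) [_ [y Ny <-] ?]; exists y.
Qed.

Lemma dual_norm_gt0 z : z != 0 -> 0 < dual_norm N z.
Proof.
move=> /dot_gt0 /lt_le_trans /(_ (dot_le_dual_norm z z)).
apply: contraTT; rewrite -!leNgt => z_le0.
by rewrite mulr_le0_ge0// (seminorm_ge0 N_semi).
Qed.

(** One inequality suffices: apply it to a and to its inverse. *)
Lemma dual_normZ a z : 0 < a -> dual_norm N (a *: z) = a * dual_norm N z.
Proof.
have le_scale b w : 0 < b -> dual_norm N (b *: w) <= b * dual_norm N w.
  move=> b0; apply: ge_sup; first exact: (dual_norm_set_has_sup _).1.
  move=> _ [y Ny <-]; rewrite dotZl ler_pM2l//.
  by apply: ub_le_sup (dual_norm_set_has_sup w).2 _ _; exists y.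
move=> a0; apply/eqP; rewrite eq_le le_scale//=.
rewrite mulrC -ler_pdivlMr// mulrC.
by rewrite -{1}(scale1r z) -(mulVf (lt0r_neq0 a0)) -scalerA le_scale ?invr_gt0.
Qed.

End Norm.

(** * Separation from a closed convex set *)

(** For s outside the sum f(C) + K, each y in C has a neighbourhood on which s',
    close to s, keeps s' - f y out of K; compactness of C makes the closeness
    uniform in y. *)
Lemma closed_compact_image_add (R : realType) (T : topologicalType)
    (V : normedModType R) (f : T -> V) (C : set T) (K : set V) :
  continuous f -> compact C -> closed K ->
  closed [set s | exists2 y, C y & K (s - f y)].
Proof.
move=> f_cont /compact_near_coveringP C_cover K_closed.
rewrite -openC openE => s /= s_out.
have := C_cover V (nbhs s) (fun s' y => ~ K (s' - f y)) (nbhs_filter s).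
case/(_ _)/Wrap => [y Cy|]; last first.
  by apply: filterS => s' s'_out [y Cy Ksy]; exact: s'_out Cy Ksy.
have /(_ (y, s)) sub_cont : continuous (fun ys : T * V => ys.2 - f ys.1).
  move=> ys; apply: cvgB; first exact: cvg_snd.
  by apply: continuous_comp; [exact: cvg_fst|exact: f_cont].
apply: (sub_cont (~` K)); apply: open_nbhs_nbhs; split; first exact: closed_openC.
by move=> Ksy; apply: s_out; exists y.
Qed.

(** The points of S no farther from 0 than some s0 in S form a compact set. *)
Lemma exists_min_dot (R : realType) (n : nat) (S : set 'cV[R]_n) :
  closed S -> S !=set0 -> exists2 w, S w & forall s, S s -> dot w w <= dot s s.
Proof.
move=> S_closed [s0 Ss0].
pose T := S `&` (fun s => dot s s) @^-1` [set r | r <= dot s0 s0].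
have T_compact : compact T.
  apply: (@bounded_closed_compact_cV _ _ _ (1 + dot s0 s0)) => [x [_ /= x_le]|].
    rewrite [leLHS]/Num.norm /= mx_normrE; apply/bigmax_leP.
    split=> [|[i j] _ /=]; first by rewrite addr_ge0// (le_trans _ x_le)// dot_ge0.
    rewrite ord1; have := le_trans (sqr_coord_le_dot x i) x_le.
    (* a ^+ 2 <= v gives a <= 1 + v, hence the radius 1 + dot s0 s0. *)
    rewrite -real_normK ?num_real//.
    by have := normr_ge0 (x i 0); nra.
  apply: closedI S_closed _.
  by apply: preimage_closed (@closed_le _ _) => x _; exact: dot_self_continuous.
have [|w /set_mem [Sw w_le] w_min] := compact_EVT_min _ T_compact
  (continuous_subspaceT (@dot_self_continuous R n)).
  by exists s0; split => //=.
exists w => // s Ss; have [s_le|/ltW s_ge] := leP (dot s s) (dot s0 s0).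
  by apply: w_min; apply/mem_set.
exact: le_trans w_le s_ge.
Qed.

Lemma convex_setP (R : realType) (V : lmodType R) (S : set V) :
  @convex_set R V S <->
  forall x y (t : R), S x -> S y -> 0 <= t <= 1 -> S (t *: x + (1 - t) *: y).
Proof.
split=> [S_conv x y t Sx Sy /andP[t0 t1]|S_conv x y t /set_mem Sx /set_mem Sy].
  by have /set_mem := S_conv x y (Itv01 t0 t1) (mem_set Sx) (mem_set Sy).
by apply/mem_set; apply: S_conv => //; rewrite ge0 le1.
Qed.

(** If w . s < w . w, moving from w a little towards s would decrease the
    Euclidean norm below that of w. *)
Lemma min_dot_separates (R : realType) (n : nat) (S : set 'cV[R]_n) w :
  @convex_set R 'cV[R]_n S -> S w -> (forall s, S s -> dot w w <= dot s s) ->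
  forall s, S s -> dot w w <= dot w s.
Proof.
move=> /convex_setP S_conv Sw w_min s Ss; rewrite leNgt; apply/negP => lt_ws.
pose a := dot w w - dot w s; pose q := dot (s - w) (s - w).
have a0 : 0 < a by rewrite subr_gt0.
have q0 : 0 <= q := dot_ge0 _.
have aq0 : 0 < a + q by rewrite ltr_wpDr.
(* Along w + t (s - w) the squared norm is w . w - 2 t a + t^2 q; this t makes
   it smaller than w . w. *)
pose t := a / (a + q).
have t0 : 0 < t by rewrite divr_gt0.
have t01 : 0 <= t <= 1 by rewrite (ltW t0) ler_pdivrMr// mul1r lerDl.
have := w_min _ (S_conv _ _ _ Ss Sw t01).
have -> : t *: s + (1 - t) *: w = w + t *: (s - w).
  by rewrite scalerBl scale1r scalerBr addrCA addrA.
rewrite dotDl !dotDr !dotZl !dotZr -/q (dotC _ w) dotBr -/a -(opprB (dot w w)) -/a.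
have t_def : t * (a + q) = a by rewrite divfK// gt_eqF.
nra.
Qed.

(** Used to turn boundedness below on the rays of a cone into nonnegativity. *)
Lemma nonneg_slope (R : realType) (a c : R) :
  (forall t, 0 <= t -> c <= t * a) -> 0 <= a.
Proof.
move=> H; rewrite leNgt; apply/negP => a0.
have t0 : 0 <= (1 + `|c|) / - a by rewrite divr_ge0 ?addr_ge0// oppr_ge0 ltW.
have := H _ t0; rewrite invrN mulrN mulNr divfK ?lt_eqF//.
by have := ler_norm (- c); rewrite normrN; lra.
Qed.

(** * Certificates for a convex set that misses the obstacle *)

Section Separation.
Context {R : realType} {l n : nat}.
Variables (K : set 'cV[R]_l) (A : 'M[R]_(l, n)) (b : 'cV[R]_l).
Hypotheses (K_cone : cone K) (K_closed : closed K)
  (K_convex : @convex_set R 'cV[R]_l K) (K0 : K 0).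

(** C misses the obstacle exactly when 0 is not in A C - b + K; the point of least
    Euclidean norm of this closed convex set is the functional. *)
Lemma separating_functional (C : set 'cV[R]_n) :
    compact C -> @convex_set R 'cV[R]_n C -> C !=set0 ->
    C `&` obstacle K A b = set0 ->
  exists2 lam, dual_cone K lam & forall y, C y -> 0 < dot (A *m y - b) lam.
Proof.
move=> C_compact /convex_setP C_conv [y0 Cy0] CO.
pose f (y : 'cV[R]_n) := A *m y - b.
pose S := [set s | exists2 y, C y & K (s - f y)].
have f_cont : continuous f by exact: affine_continuous.
have fS y k : C y -> K k -> S (f y + k).
  by move=> Cy Kk; exists y; rewrite // addrC addKr.
have S_closed : closed S by exact: closed_compact_image_add.
have S_conv : @convex_set R 'cV[R]_l S.
  apply/convex_setP => x y t [u Cu Kx] [v Cv Ky] t01.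
  exists (t *: u + (1 - t) *: v); first exact: C_conv.
  have -> : t *: x + (1 - t) *: y - f (t *: u + (1 - t) *: v) =
      t *: (x - f u) + (1 - t) *: (y - f v).
    rewrite /f mulmxDr -!scalemxAr; apply/colP => i; rewrite !mxE; ring.
  by move/convex_setP: K_convex; apply.
have [|w Sw w_min] := exists_min_dot S_closed.
  by exists (f y0 + 0); apply: fS.
have sep := min_dot_separates S_conv Sw w_min.
have w0 : 0 < dot w w.
  apply: dot_gt0; apply/eqP => w_eq0; move: Sw; rewrite w_eq0 => -[y Cy].
  rewrite sub0r /f opprB => Ky.
  by have : set0 y by rewrite -CO.
exists w => [k Kk|y Cy]; last first.
  by rewrite dotC -[_ - b]addr0; apply: lt_le_trans w0 (sep _ (fS _ _ Cy K0)).
apply: (@nonneg_slope _ _ (dot w w - dot w (f y0))) => t t0.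
by rewrite lerBlDl -dotZr -dotDr; apply: sep; apply: fS => //; exact: K_cone.
Qed.

Lemma weak_duality y lam :
  dual_cone K lam -> obstacle K A b y -> dot (A *m y - b) lam <= 0.
Proof. by move=> lamK /lamK; rewrite -opprB dotNr dotC oppr_ge0. Qed.

(** Were A^T lam zero, A y - b would pair with lam to the same number for every y,
    positive on C and nonpositive on the nonempty obstacle. *)
Lemma dual_certificate (N : 'cV[R]_n -> R) (C : set 'cV[R]_n) :
    is_norm N -> compact C -> @convex_set R 'cV[R]_n C -> C !=set0 ->
    obstacle K A b !=set0 -> C `&` obstacle K A b = set0 ->
  exists lam, [/\ dual_cone K lam, dual_norm N (A^T *m lam) = 1
    & forall y, C y -> 0 < dot (A *m y - b) lam].
Proof.
move=> N_norm C_compact C_conv C_neq0 [y0 Oy0] CO.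
have [lam lamK lam_gt0] := separating_functional C_compact C_conv C_neq0 CO.
have z0 : A^T *m lam != 0.
  apply/eqP => z_eq0; have [y1 Cy1] := C_neq0.
  have := lam_gt0 _ Cy1; have := weak_duality lamK Oy0.
  by rewrite !dotBl (dot_mulmxl A y0) (dot_mulmxl A y1) z_eq0 !dot0l; lra.
have m0 := dual_norm_gt0 N_norm z0; set m := dual_norm _ _ in m0.
have mV0 : 0 < m^-1 by rewrite invr_gt0.
exists (m^-1 *: lam); split=> [s /lamK s_ge0||y /lam_gt0 y_gt0].
- by rewrite dotZl mulr_ge0// ltW.
- by rewrite -scalemxAr (dual_normZ N_norm)// mulVf// gt_eqF.
- by rewrite dotZr mulr_gt0.
Qed.

End Separation.

(** * Distance and penetration of a point *)

Section PointMass.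
Context {R : realType} {V : lmodType R} {N : V -> R}.
Hypothesis N_norm : is_norm N.
Let N_ge0 := seminorm_ge0 (norm_semi N_norm).
Variables (p : V) (O : set V).

Lemma translate_set1 (t : V) : translate [set p] t = [set p + t].
Proof. by rewrite /translate image_set1. Qed.

Lemma translate_point_meets (t : V) : translate [set p] t `&` O !=set0 <-> O (p + t).
Proof.
by rewrite translate_set1; split=> [[_ [-> //]]|Opt]; exists (p + t).
Qed.

Lemma translate_point_misses (t : V) : translate [set p] t `&` O = set0 <-> ~ O (p + t).
Proof.
rewrite -translate_point_meets; split=> [->|/set0P/negP]; first by case.
by rewrite negbK => /eqP.
Qed.

Lemma dist_ge0 : (0 <= dist N [set p] O)%E.
Proof. by apply: le_ereal_inf_tmp => _ [t _ <-]; rewrite lee_fin N_ge0. Qed.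

Lemma penetration_ge0 : (0 <= penetration N [set p] O)%E.
Proof. by apply: le_ereal_inf_tmp => _ [t _ <-]; rewrite lee_fin N_ge0. Qed.

Lemma dist_ge (r : R) :
  (forall t, O (p + t) -> r <= N t) -> (r%:E <= dist N [set p] O)%E.
Proof.
move=> H; apply: le_ereal_inf_tmp => _ [t /translate_point_meets/H ? <-].
by rewrite lee_fin.
Qed.

Lemma dist_le t : O (p + t) -> (dist N [set p] O <= (N t)%:E)%E.
Proof.
by move=> Opt; apply: ereal_inf_lbound; exists t => //; apply/translate_point_meets.
Qed.

Lemma penetration_le t : ~ O (p + t) -> (penetration N [set p] O <= (N t)%:E)%E.
Proof.
by move=> Opt; apply: ereal_inf_lbound; exists t => //; apply/translate_point_misses.
Qed.

Lemma penetration_lt (r : R) : (penetration N [set p] O < r%:E)%E ->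
  exists2 t, ~ O (p + t) & N t < r.
Proof.
move=> /ereal_inf_lt[_ [t /translate_point_misses ? <-]]; rewrite lte_fin.
by exists t.
Qed.

End PointMass.

(** * Duality for the signed distance *)

Lemma norm_ball_compact (R : realType) (n : nat) (N : 'cV[R]_n -> R) p (r : R) :
  is_norm N -> compact [set y | N (y - p) <= r].
Proof.
move=> N_norm; have [c c0 N_ge] := sup_norm_le_norm N_norm.
apply: (@bounded_closed_compact_cV _ _ _ (c * r + `|p|)) => [y /= yr|].
  rewrite -[y in leLHS](subrK p); apply: le_trans (ler_normD _ _) _.
  by rewrite lerD2r; apply: le_trans (N_ge _) _; rewrite ler_pM2l.
(* The identity matrix presents the translation as an affine map. *)
have -> : [set y | N (y - p) <= r] =
    (fun y => 1%:M *m y - p) @^-1` (N @^-1` [set s | s <= r]).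
  by apply/seteqP; split=> y /=; rewrite mul1mx.
apply: preimage_closed => [y _|]; first exact: affine_continuous.
apply: preimage_closed (@closed_le _ _) => y _.
exact: seminorm_continuous (norm_semi N_norm) y.
Qed.

Lemma norm_ball_convex (R : realType) (V : lmodType R) (N : V -> R) p (r : R) :
  is_norm N -> @convex_set R V [set y | N (y - p) <= r].
Proof.
move=> [_ NZ ND]; apply/convex_setP => x y t /= xr yr /andP[t0 t1].
have -> : t *: x + (1 - t) *: y - p = t *: (x - p) + (1 - t) *: (y - p).
  rewrite !scalerBr addrACA -opprD -scalerDl.
  by rewrite (addrC t) subrK scale1r.
apply: le_trans (ND _ _) _; rewrite !NZ ger0_norm// ger0_norm ?subr_ge0//.
nra.
Qed.

Section Duality.
Context {R : realType} {l n : nat}.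
Variables (K : set 'cV[R]_l) (A : 'M[R]_(l, n)) (b : 'cV[R]_l).
Variables (N : 'cV[R]_n -> R) (N_norm : is_norm N) (p : 'cV[R]_n).
Let O := obstacle K A b.

Lemma certificate_le_sdist d lam :
    dual_cone K lam -> dual_norm N (A^T *m lam) = 1 ->
    d < dot (A *m p - b) lam ->
  (d%:E < sdist N [set p] O)%E.
Proof.
move=> lamK lam1; set m := dot _ _ => dm; set z := A^T *m lam in lam1.
have shift t : dot (A *m (p + t) - b) lam = m + dot z t.
  by rewrite mulmxDr addrAC dotDl (dot_mulmxl A t).
have z_le t : dot z t <= N t.
  by have := dot_le_dual_norm N_norm z t; rewrite lam1 mul1r.
have N_opp t : N (- t) = N t := seminormN (norm_semi N_norm) t.
have [Op|nOp] := pselect (O p).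
  have m0 : m <= 0 := weak_duality lamK Op.
  (* Pushing by - e > - m along a near-maximizer y of z is enough to leave O, and
     costs N (- e *: y) <= - e < - d. *)
  have [e [de em]] : exists e, d < e /\ e < m.
    by exists ((d + m) / 2); split; lra.
  have e0 : 0 < - e by lra.
  have [|y Ny yz] := @dual_norm_gt _ _ _ N_norm z (m / e).
    by rewrite lam1 ltr_ndivrMr ?mul1r// -oppr_gt0.
  have out : ~ O (p + - e *: y).
    move=> /(weak_duality lamK); rewrite shift dotZr.
    by move: yz; rewrite ltr_ndivrMr -?oppr_gt0//; lra.
  apply: (@lt_le_trans _ _ (0 - (- e)%:E)%E); first by rewrite sub0e -EFinN lte_fin opprK.
  apply: leeB; first exact: dist_ge0.
  apply: le_trans (penetration_le out) _; rewrite lee_fin.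
  by rewrite (norm_semi N_norm).1 gtr0_norm// ger_pMr.
apply: (@lt_le_trans _ _ (m%:E - 0)%E); first by rewrite sube0 lte_fin.
apply: leeB.
  apply: dist_ge => t /(weak_duality lamK); rewrite shift.
  by have := z_le (- t); rewrite N_opp dotNr; lra.
have -> : 0%E = (N 0)%:E by rewrite (seminorm0 (norm_semi N_norm)).
by apply: penetration_le; rewrite addr0.
Qed.

Lemma sdist_certificate d :
    cone K -> closed K -> @convex_set R 'cV[R]_l K -> K 0 -> O !=set0 ->
    (d%:E < sdist N [set p] O)%E ->
  exists lam, [/\ dual_cone K lam, dual_norm N (A^T *m lam) = 1
    & d < dot (A *m p - b) lam].
Proof.
move=> K_cone K_closed K_convex K0 O_neq0 sd.
have N_opp t : N (- t) = N t := seminormN (norm_semi N_norm) t.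
have N0 : N 0 = 0 := seminorm0 (norm_semi N_norm).
pose certify C := @dual_certificate R l n K A b K_cone K_closed K_convex K0 N C N_norm.
have shift t lam : dot (A *m (p + t) - b) lam =
    dot (A *m p - b) lam + dot (A^T *m lam) t.
  by rewrite mulmxDr addrAC dotDl (dot_mulmxl A t).
(* A negative bound asks only for one point outside O at N-distance less than
   - d from p, which is p itself when p is outside. *)
have [d0|d0] := ltP d 0.
  have [t out Nt] : exists2 t, ~ O (p + t) & N t < - d.
    have [Op|nOp] := pselect (O p); last by exists 0; rewrite ?addr0// N0 oppr_gt0.
    apply: (@penetration_lt _ _ _ p); rewrite EFinN lteNr.
    apply: lt_le_trans sd _; rewrite -[leRHS]add0e; apply: leeB => //.
    by have <- : (N 0)%:E = 0%E by [rewrite N0]; apply: dist_le; rewrite addr0.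
  have [|||||lam [lamK lam1 lam_gt0]] := certify [set p + t].
  - exact: compact_set1.
  - by apply/convex_setP => x y s /= -> -> _; rewrite -scalerDl addrC subrK scale1r.
  - by exists (p + t).
  - exact: O_neq0.
  - by apply/seteqP; split=> // y [/= ->].
  exists lam; split=> //.
  have := lam_gt0 _ erefl; rewrite shift.
  by have := dot_le_dual_norm N_norm (A^T *m lam) t; rewrite lam1; lra.
have [r dr r_lt] : exists2 r, d < r & (r%:E < dist N [set p] O)%E.
  have : (d%:E < dist N [set p] O)%E.
    apply: lt_le_trans sd _; rewrite -[leRHS]sube0; apply: leeB => //.
    exact: penetration_ge0.
  case: (dist _ _ _) => [s|_|//]; last by exists (d + 1); rewrite ?ltry//; lra.
  by rewrite lte_fin => ds; exists ((d + s) / 2); rewrite ?lte_fin; lra.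
have r0 : 0 < r by lra.
have [|||||lam [lamK lam1 lam_gt0]] := certify [set y | N (y - p) <= r].
- exact: norm_ball_compact.
- exact: norm_ball_convex.
- by exists p; rewrite /= subrr N0 ltW.
- exact: O_neq0.
- apply/seteqP; split=> // y [/= yr Oy].
  have : O (p + (y - p)) by rewrite addrC subrK.
  move=> /(@dist_le _ _ N) /(lt_le_trans r_lt); rewrite lte_fin; lra.
exists lam; split=> //.
(* Test lam at p - r y, where y nearly maximizes A^T lam over the unit ball, so
   that pairing A^T lam with r y still gives more than d. *)
have [|y Ny yz] := @dual_norm_gt _ _ _ N_norm (A^T *m lam) (d / r).
  by rewrite lam1 ltr_pdivrMr// mul1r.
have := lam_gt0 (p + - (r *: y)); rewrite shift dotNr dotZr /= addrAC subrr add0r N_opp.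
rewrite (norm_semi N_norm).1 gtr0_norm// ger_pMr// => /(_ Ny).
by move: yz; rewrite ltr_pdivrMr//; lra.
Qed.

End Duality.

Theorem theorem1 (R : realType) (l n : nat) (n_ge1 : (1 <= n)%N)
    (K : set 'cV[R]_l) (A : 'M[R]_(l, n)) (b : 'cV[R]_l)
    (K_cone : cone K)
    (K_closed : closed K)
    (K_convex : @convex_set R 'cV[R]_l K)
    (K_pointed : pointed_cone K)
    (K_solid : interior K !=set0)
    (O_convex : @convex_set R 'cV[R]_n (obstacle K A b))
    (O_compact : compact (obstacle K A b))
    (O_relint : relative_interior (obstacle K A b) !=set0)
    (N : 'cV[R]_n -> R) (N_norm : is_norm N)
    (p : 'cV[R]_n) (d : R) :
  (d%:E < sdist N [set p] (obstacle K A b))%E <->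
  exists lam : 'cV[R]_l,
    [/\ cone_le (dual_cone K) 0 lam,
        d < dot (A *m p - b) lam
      & dual_norm N (A^T *m lam) = 1].
Proof.
have K0 : K 0.
  have [k /interior_subset Kk] := K_solid.
  by rewrite -(scale0r k); exact: K_cone.
have O_neq0 : obstacle K A b !=set0 by have [y [Oy _]] := O_relint; exists y.
split=> [sd|[lam [lamK dlam lam1]]].
  have [lam [lamK lam1 dlam]] :=
    sdist_certificate N_norm K_cone K_closed K_convex K0 O_neq0 sd.
  by exists lam; rewrite /cone_le subr0.
by apply: certificate_le_sdist lam1 dlam => //; move: lamK; rewrite /cone_le subr0.
Qed.
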